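(* There is an algebraic algorithm running in $n^{\omega_s+o(1)}$ operations with the following property. Let $A$ and $B$ be $n\times n$ Boolean matrices. Let $A'$ be the lift of $A$ to a $0/1$ complex matrix, and let $B'$ be the complex matrix obtained from $B$ by replacing each zero entry by $0$ and each nonzero entry by a random choice of $1$ or $2$ (independently and uniformly). Then from $A',B'$ the algorithm computes an $n\times n$ matrix $C$ such that, for all $i,j$: the $(i,j)$ entry of $C$ is $0$ if the $(i,j)$ entry of the Boolean matrix product of $A$ and $B$ is $0$; otherwise the $(i,j)$ entry of $C$ is nonzero with probability at least $1/2$.
   Context: The Boolean matrix product is the matrix product over the Boolean semiring $\{0,1\}$ with ''and'' as multiplication and ''or'' as addition. An algebraic algorithm performs arithmetic operations over $\mathbb{C}$, and its running time is the number of arithmetic operations; probability is over the random choices made in forming $B'$. A third-order tensor over $\mathbb{C}$ is written as a trilinear form $T=\sum_{i,j,k} T_{i,j,k}\,\hat x_i\hat y_j\hat z_k$ in three disjoint finite sets of formal variables. Its rank $R(T)$ is the least $r$ such that $T$ is a sum of $r$ products $\alpha(\hat x)\beta(\hat y)\gamma(\hat z)$ of linear forms. The support $\mathrm{supp}(T)$ is the set of monomials with nonzero coefficient. The s-rank $R_s(T)$ is the minimum of $R(T')$ over all tensors $T'$ in the same variables with $\mathrm{supp}(T')=\mathrm{supp}(T)$. With $\langle n,n,n\rangle=\sum_{i,j,k\in[n]} \hat x_{i,j}\hat y_{j,k}\hat z_{k,i}$, the s-rank exponent of matrix multiplication is $\omega_s=\inf\{\tau\in\mathbb{R}: R_s(\langle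 n,n,n\rangle)=O(n^\tau)\}$. *)

(* Defs.v *)
From HB Require Import structures.
From mathcomp Require Export all_boot all_order all_algebra.
From mathcomp Require Export all_classical all_reals all_analysis.
From mathcomp Require Export complex.

Set Implicit Arguments.
Unset Strict Implicit.
Unset Printing Implicit Defensive.

Import Order.TTheory GRing.Theory Num.Theory.
Import numFieldNormedType.Exports.

Local Open Scope classical_set_scope.
Local Open Scope ring_scope.
Local Open Scope complex_scope.

Section Tensors.
Variable F : fieldType.

(* [T x y z] is the coefficient of the monomial x y z of the trilinear form;
   the three slots of [T] keep the three sets of variables disjoint. *)
Definition tensor (X Y Z : finType) := X -> Y -> Z -> F.

Section Rank.
Variables X Y Z : finType.

Definition sum_of_products (T : tensor X Y Z) (r : nat) : Prop :=
  exists (alpha : 'I_r -> X -> F) (beta : 'I_r -> Y -> F)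
         (gamma : 'I_r -> Z -> F),
    forall x y z, T x y z = \sum_(l < r) alpha l x * beta l y * gamma l z.

Lemma sum_of_products_exists (T : tensor X Y Z) :
  exists r, `[< sum_of_products T r >].
Proof.
exists #|{: X * Y * Z}|; apply/asboolP.
pose t (l : 'I_#|{: X * Y * Z}|) : X * Y * Z := enum_val l.
exists (fun l x => (T (t l).1.1 (t l).1.2 (t l).2) * (x == (t l).1.1)%:R),
  (fun l y => (y == (t l).1.2)%:R), (fun l z => (z == (t l).2)%:R) => x y z.
rewrite (bigD1 (enum_rank (x, y, z))) //= /t enum_rankK /= !eqxx !mulr1.
rewrite big1 ?addr0 // => l ne_l; rewrite -!mulrA -!natrM !mulnb.
case: eqP => [ex|]; last by rewrite mulr0.
case: eqP => [ey|]; last by rewrite mulr0.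
case: eqP => [ez|]; last by rewrite mulr0.
case/eqP: ne_l; apply: enum_val_inj; rewrite enum_rankK ex ey ez.
by case: (enum_val l) => [[]].
Qed.

Definition tensor_rank (T : tensor X Y Z) : nat :=
  ex_minn (sum_of_products_exists T).

Definition tensor_supp (T : tensor X Y Z) : {set X * Y * Z} :=
  [set t | T t.1.1 t.1.2 t.2 != 0]%SET.

Lemma s_rank_exists (T : tensor X Y Z) :
  exists r, `[< exists T' : tensor X Y Z,
                  tensor_supp T' = tensor_supp T /\ tensor_rank T' = r >].
Proof. by exists (tensor_rank T); apply/asboolP; exists T. Qed.

Definition s_rank (T : tensor X Y Z) : nat := ex_minn (s_rank_exists T).

End Rank.

Definition matmul_tensor (n : nat) :
    tensor ('I_n * 'I_n)%type ('I_n * 'I_n)%type ('I_n * 'I_n)%type :=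
  fun x y z => \sum_(i < n) \sum_(j < n) \sum_(k < n)
    ((x == (i, j)) && (y == (j, k)) && (z == (k, i)))%:R.

End Tensors.

Arguments matmul_tensor F n : clear implicits.

Definition omega_s (R : realType) : R :=
  inf [set tau : R |
    (fun n : nat => (s_rank (matmul_tensor R[i] n))%:R : R^o) =O_\oo
    (fun n : nat => n%:R `^ tau : R^o)].

Section StraightLinePrograms.
Variable F : fieldType.

Inductive arith_op := OpAdd | OpSub | OpMul | OpDiv.

(* [Result k] is the result of the k-th instruction, counted from 0. *)
Inductive operand (I : Type) :=
  Input of I | Const of F | Result of nat.

Record instruction (I : Type) :=
  Instr { opcode : arith_op; left_arg : operand I; right_arg : operand I }.

(* A program with inputs indexed by I and outputs indexed by O. *)
Record program (I O : Type) :=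
  Program { code : seq (instruction I); output : O -> operand I }.

Definition num_ops I O (p : program I O) : nat := size (code p).

(* The semantics is partial: a division by zero, or a reference to a result
   not yet computed, makes the program undefined on the given input.  In
   particular the convention 0^-1 = 0 cannot be used as a zero test. *)
Definition eval_operand I (inp : I -> F) (mem : seq F) (o : operand I) :
    option F :=
  match o with
  | Input i => Some (inp i)
  | Const c => Some c
  | Result k => onth mem k
  end.

Definition eval_op (op : arith_op) (x y : F) : option F :=
  match op with
  | OpAdd => Some (x + y)
  | OpSub => Some (x - y)
  | OpMul => Some (x * y)
  | OpDiv => if y == 0 then None else Some (x / y)
  end.

Definition eval_instr I (inp : I -> F) (mem : seq F) (c : instruction I) :
    option F :=
  obind (fun x => obind (fun y => eval_op (opcode c) x y)
                        (eval_operand inp mem (right_arg c)))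
        (eval_operand inp mem (left_arg c)).

Fixpoint exec I (inp : I -> F) (mem : seq F) (s : seq (instruction I)) :
    option (seq F) :=
  if s is c :: s' then
    obind (fun v => exec inp (rcons mem v) s') (eval_instr inp mem c)
  else Some mem.

Definition computes I O (p : program I O) (inp : I -> F) (out : O -> F) :
    Prop :=
  exists2 mem, exec inp [::] (code p) = Some mem &
    forall o, eval_operand inp mem (output p o) = Some (out o).

(* Programs taking two n x n matrices (their entries are the inputs of the
   left, resp. right, summand) and returning one n x n matrix. *)
Definition mx_program (n : nat) :=
  program (('I_n * 'I_n) + ('I_n * 'I_n)) ('I_n * 'I_n).

Definition mx_computes n (p : mx_program n) (A B C : 'M[F]_n) : Prop :=
  computes p
    (fun v => match v with inl ij => A ij.1 ij.2 | inr ij => B ij.1 ij.2 end)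
    (fun ij => C ij.1 ij.2).

Definition lift_mx n (A : 'M[bool]_n) : 'M[F]_n := \matrix_(i, j) (A i j)%:R.

(* [c i j] decides whether a nonzero entry (i, j) becomes 1 or 2. *)
Definition choice_lift_mx n (B c : 'M[bool]_n) : 'M[F]_n :=
  \matrix_(i, j) (if B i j then if c i j then 2 else 1 else 0).

End StraightLinePrograms.

(* Not [A *m B]: the ring structure of MathComp on [bool] is the field F_2. *)
Definition bool_mulmx n (A B : 'M[bool]_n) : 'M[bool]_n :=
  \matrix_(i, j) \big[orb/false]_(k < n) (A i k && B k j).

(* Probability of [E] when the choice matrix is uniform, that is, when its
   entries are independent and uniform in [bool]. *)
Definition choice_prob (R : realType) n (E : {set 'M[bool]_n}) : R :=
  #|E|%:R / #|{: 'M[bool]_n}|%:R.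

(* Main.v *)
Require Import Defs.
From mathcomp Require Import ring lra.

(** Why the theorem holds.  Fix [sigma > omega_s].  Some [m > 1] has a tensor [T]
    with the support of the matrix multiplication tensor of size [m] and rank
    [r < m ^ sigma].  Strassen's recursion applied to [T] in place of the true
    tensor still computes something close to a matrix product: on matrices of
    size [m ^ k] it returns [\sum_j w i j k * A i j * B j k], where each weight
    [w i j k] is a product of coefficients of [T] on its support, hence nonzero
    ([weighted_product_kron]).  One level costs [r] recursive calls and
    [O(m ^ (2 * k))] additions and scalings, and [m ^ 2 <= r]
    ([sqrn_leq_s_rank_matmul]), so the total is [O(m ^ (sigma * k))]; padding
    with zeros gives every size [n] at cost [O(n ^ sigma)]
    ([weighted_product_leq_powR]).

    A weighted product detects the Boolean product.  If no [j] has both [A i j]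
    and [B j k] set, all terms vanish.  If some [j] does, the entry is an affine
    function of the random value at [(j, k)] with the nonzero slope [w i j k], so
    switching that value between 1 and 2 cannot keep it at zero; the switch is
    an involution on choices, which gives probability at least one half
    ([weighted_choice_prob]).

    A single family of programs with exponent [omega_s + o(1)] needs no
    diagonal argument: for each [n] take a shortest program computing some
    weighted product, so that its length obeys the bound for each [sigma] at
    once ([exponent_of_count]). *)

Set Implicit Arguments.
Unset Strict Implicit.
Unset Printing Implicit Defensive.

Import Order.TTheory GRing.Theory Num.Theory.
Import numFieldNormedType.Exports.

Local Open Scope classical_set_scope.
Local Open Scope ring_scope.
Local Open Scope complex_scope.

(** * Cost calculus for straight-line programs *)

Section Costs.
Variable F : fieldType.

(** Soundness is asked on all inputs: the weighted products below are computed
    by division-free programs, and their inputs are only specialised to the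
    lifted Boolean matrices at the very end. *)
Definition computable_within (I O : Type) (f : (I -> F) -> O -> F) (s : nat) :=
  exists2 p : program F I O, (num_ops p <= s)%N &
    forall inp, computes p inp (f inp).

(** Composing two programs runs the second one after the [d] instructions of
    the first: its result references shift by [d], and its inputs become the
    outputs of the first. *)
Definition relocate (I J : Type) (out : I -> operand F J) (d : nat)
    (o : operand F I) : operand F J :=
  match o with
  | Input i => out i
  | Const c => Const J c
  | Result k => Result F J (d + k)
  end.

Definition relocate_instr (I J : Type) (out : I -> operand F J) (d : nat)
    (c : instruction F I) : instruction F J :=
  Instr (opcode c) (relocate out d (left_arg c)) (relocate out d (right_arg c)).

Lemma onth_catl (T : Type) (s t : seq T) k v :
  onth s k = Some v -> onth (s ++ t) k = Some v.
Proof. by elim: s k => [|x s IHs] [|k] //=; exact: IHs. Qed.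

Lemma onth_catr (T : Type) (s t : seq T) k :
  onth (s ++ t) (size s + k) = onth t k.
Proof. by elim: s. Qed.

Lemma eval_operand_catl (I : Type) (inp : I -> F) mem mem' o v :
  eval_operand inp mem o = Some v -> eval_operand inp (mem ++ mem') o = Some v.
Proof. by case: o => //= k; exact: onth_catl. Qed.

Lemma size_exec (I : Type) (inp : I -> F) mem mem' s :
  exec inp mem s = Some mem' -> size mem' = (size mem + size s)%N.
Proof.
elim: s mem => [|c s IHs] mem /=; first by case=> ->; rewrite addn0.
by case: eval_instr => //= v /IHs ->; rewrite size_rcons addSnnS.
Qed.

Lemma exec_cat (I : Type) (inp : I -> F) mem mem' s t :
  exec inp mem s = Some mem' -> exec inp mem (s ++ t) = exec inp mem' t.
Proof.
elim: s mem => [|c s IHs] mem /=; first by case=> ->.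
by case: eval_instr => //= v /IHs.
Qed.

Section Relocation.
Variables (I J : Type) (inpI : I -> F) (inpJ : J -> F).
Variables (out : I -> operand F J) (mem0 : seq F).
Hypothesis outE : forall i, eval_operand inpJ mem0 (out i) = Some (inpI i).

Lemma eval_relocate mem o v : eval_operand inpI mem o = Some v ->
  eval_operand inpJ (mem0 ++ mem) (relocate out (size mem0) o) = Some v.
Proof.
case: o => [i|c|k] //=; last by rewrite onth_catr.
by move=> [<-]; exact/eval_operand_catl/outE.
Qed.

Lemma exec_relocate mem mem' s : exec inpI mem s = Some mem' ->
  exec inpJ (mem0 ++ mem) (map (relocate_instr out (size mem0)) s)
    = Some (mem0 ++ mem').
Proof.
elim: s mem => [|c s IHs] mem /=; first by case=> ->.
rewrite /eval_instr /=.
case El: (eval_operand _ _ (left_arg c)) => [x|] //=.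
case Er: (eval_operand _ _ (right_arg c)) => [y|] //=.
rewrite (eval_relocate El) (eval_relocate Er) /=.
by case: eval_op => //= v /IHs; rewrite rcons_cat.
Qed.

End Relocation.

Lemma computable_ext I O (f g : (I -> F) -> O -> F) s :
  (forall inp o, f inp o = g inp o) ->
  computable_within f s -> computable_within g s.
Proof.
move=> fg [p ps pf]; exists p => // inp; have [mem pE fE] := pf inp.
by exists mem => // o; rewrite fE fg.
Qed.

(** Copying inputs, duplicating, permuting or dropping them, and inserting
    constants are wiring only, hence cost nothing. *)
Lemma computable_atoms I O (g : O -> I + F) :
  computable_within
    (fun inp o => match g o with inl i => inp i | inr c => c end) 0.
Proof.
exists (Program [::] (fun o => match g o with
  inl i => Input F i | inr c => Const I c end)) => // inp.
by exists [::] => // o /=; case: (g o).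
Qed.

Lemma computable_select I O (g : O -> I) :
  computable_within (fun (inp : I -> F) o => inp (g o)) 0.
Proof. exact: (computable_atoms (inl \o g)). Qed.

Lemma computable_comp I O P (f : (I -> F) -> O -> F) (g : (O -> F) -> P -> F)
    s t :
  computable_within f s -> computable_within g t ->
  computable_within (fun inp => g (f inp)) (s + t).
Proof.
move=> [p ps pf] [q qt qg].
pose d := size (code p).
exists (Program (code p ++ map (relocate_instr (output p) d) (code q))
                (fun o => relocate (output p) d (output q o))).
  by rewrite /num_ops /= size_cat size_map leq_add.
move=> inp; have [mem pE fE] := pf inp.
have [mem' qE gE] := qg (f inp).
have dE : d = size mem by rewrite (size_exec pE).
exists (mem ++ mem') => [|u] /=.
  by rewrite (exec_cat _ pE) dE -{1}[mem]cats0; apply: exec_relocate fE _ _ _ qE.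
by rewrite dE; apply: eval_relocate fE _ _ _ (gE u).
Qed.

(** Passing the inputs through is free, since inputs stay addressable; this is
    what lets two programs share their inputs in [computable_pair]. *)
Lemma computable_keep I O (f : (I -> F) -> O -> F) s :
  computable_within f s ->
  computable_within
    (fun inp (v : O + I) => match v with inl o => f inp o | inr i => inp i end)
    s.
Proof.
move=> [p ps pf].
exists (Program (code p) (fun v => match v with
  inl o => output p o | inr i => Input F i end)) => // inp.
by have [mem pE fE] := pf inp; exists mem => //; case.
Qed.

Lemma computable_pair I O1 O2 (f : (I -> F) -> O1 -> F)
    (g : (I -> F) -> O2 -> F) s t :
  computable_within f s -> computable_within g t ->
  computable_within
    (fun inp v => match v with inl o => f inp o | inr o => g inp o end) (s + t).
Proof.
move=> /computable_keep fs gt.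
have /computable_keep g't :=
  computable_comp (computable_select (@inr O1 I)) gt.
have gf := computable_comp fs g't.
have := computable_comp gf (computable_select (fun v : O1 + O2 =>
  match v with inl o => inr (inl o) | inr o => inl o end)).
by rewrite addn0; apply: computable_ext => inp [u|u].
Qed.

Lemma computable_op op (g : F -> F -> F) I (f h : (I -> F) -> F) s t :
  (forall x y, eval_op op x y = Some (g x y)) ->
  computable_within (fun inp (_ : unit) => f inp) s ->
  computable_within (fun inp (_ : unit) => h inp) t ->
  computable_within (fun inp (_ : unit) => g (f inp) (h inp)) (s + t).+1.
Proof.
move=> opE fs ht; rewrite -addn1.
apply: (computable_comp (computable_pair fs ht)
  (g := fun inp _ => g (inp (inl tt)) (inp (inr tt)))).
exists (Program [:: Instr op (Input F (inl tt)) (Input F (inr tt))]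
                (fun _ => Result F _ 0)) => // inp.
by exists [:: g (inp (inl tt)) (inp (inr tt))] => //=; rewrite /eval_instr /= opE.
Qed.

Lemma computable_family I O (J : finType) (f : J -> (I -> F) -> O -> F) s :
  (forall j, computable_within (f j) s) ->
  computable_within (fun inp v => f v.1 inp v.2) (#|J| * s).
Proof.
move=> fs; rewrite cardE.
suff : computable_within
    (fun inp v => if v.1 \in enum J then f v.1 inp v.2 else 0)
    (size (enum J) * s).
  by apply: computable_ext => inp v; rewrite mem_enum.
elim: (enum J) => [|j l IHl] /=; first exact: (computable_atoms (fun=> inr 0)).
have := computable_comp (computable_pair (fs j) IHl)
  (computable_select (fun v : J * O =>
     if v.1 == j then inl v.2 else inr v)).
rewrite addn0 mulSn; apply: computable_ext => inp [j' o] /=.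
by rewrite inE; case: eqP => [->|].
Qed.

(** One multiplication and one addition per term, the sum starting from the
    constant 0. *)
Lemma computable_linear I (X : finType) (a : X -> F) (u : X -> I) :
  computable_within (fun inp (_ : unit) => \sum_x a x * inp (u x)) (2 * #|X|).
Proof.
rewrite cardE.
suff : computable_within
    (fun inp (_ : unit) => \sum_(x <- enum X) a x * inp (u x))
    (2 * size (enum X)).
  by apply: computable_ext => inp _; rewrite big_enum.
elim: (enum X) => [|x l IHl] /=.
  apply: (computable_ext _ (computable_atoms (fun=> inr 0))) => inp _.
  by rewrite big_nil.
have ax : computable_within (fun inp (_ : unit) => a x * inp (u x)) 1.
  exact: (computable_op (op := OpMul) (g := *%R)
    _ (computable_atoms (fun=> inr (a x))) (computable_select (fun=> u x))).
have := computable_op (op := OpAdd) (g := +%R) (fun _ _ => erefl) ax IHl.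
rewrite add1n mulnS; apply: computable_ext => inp _.
by rewrite big_cons.
Qed.

Lemma computable_linear_family I (O X : finType) (a : O -> X -> F)
    (u : O -> X -> I) :
  computable_within (fun inp v => \sum_x a v x * inp (u v x))
    (#|O| * (2 * #|X|)).
Proof.
have := computable_comp
  (computable_family (fun v => computable_linear (a v) (u v)))
  (computable_select (fun v : O => (v, tt))).
by rewrite addn0.
Qed.

(** * Weighted matrix products *)

(** The trilinear form of [weighted_product w] has the support of the matrix
    multiplication tensor as soon as no weight vanishes; it is the operation
    that a bound on the s-rank, rather than the rank, provides. *)
Definition weighted_product (J : finType) (w : J -> J -> J -> F)
    (inp : (J * J) + (J * J) -> F) (v : J * J) : F :=
  \sum_j w v.1 j v.2 * inp (inl (v.1, j)) * inp (inr (j, v.2)).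

Definition weighted_product_within (J : finType) (s : nat) :=
  exists2 w : J -> J -> J -> F, (forall i j k, w i j k != 0) &
    computable_within (weighted_product w) s.

Lemma weighted_product_unit : weighted_product_within unit 1.
Proof.
exists (fun _ _ _ => 1) => [*|]; first exact: oner_neq0.
have mul1 : computable_within (fun (inp : (unit * unit) + (unit * unit) -> F)
    (_ : unit) => inp (inl (tt, tt)) * inp (inr (tt, tt))) 1.
  exact: (computable_op (op := OpMul) (g := *%R) _
    (computable_select (fun=> inl (tt, tt)))
    (computable_select (fun=> inr (tt, tt)))).
have := computable_comp mul1 (computable_select (fun _ : unit * unit => tt)).
apply: computable_ext => inp [[] []]; rewrite /weighted_product.
by rewrite (big_pred1 tt) ?mul1r //; case.
Qed.

(** Padding with zeros: the terms indexed by [K] outside the image of [h]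
    vanish, and inserting the zeros is free. *)
Lemma weighted_product_embed (J K : finType) (h : J -> K) s :
  injective h -> weighted_product_within K s -> weighted_product_within J s.
Proof.
move=> h_inj [w w0 ws].
pose g k := [pick j | h j == k].
have hK : pcancel h g.
  rewrite /g => j; case: pickP => [i /eqP/h_inj -> //|/(_ j)].
  by rewrite eqxx.
have gK k j : g k = Some j -> h j = k.
  by rewrite /g; case: pickP => // i /eqP hi [<-].
exists (fun i j k => w (h i) (h j) (h k)) => //.
pose pad (v : K * K) : J * J + F :=
  if g v.1 is Some i then if g v.2 is Some j then inl (i, j) else inr 0
  else inr 0.
pose pad2 (v : K * K + K * K) : (J * J + J * J) + F := match v with
  | inl u => match pad u with inl x => inl (inl x) | inr c => inr c end
  | inr u => match pad u with inl x => inl (inr x) | inr c => inr c end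
  end.
have := computable_comp (computable_comp (computable_atoms pad2) ws)
  (computable_select (fun v : J * J => (h v.1, h v.2))).
rewrite add0n addn0; apply: computable_ext => inp [i k].
rewrite /weighted_product /= (bigID (fun j => g j)) /= addrC big1 ?add0r.
  rewrite (reindex_omap h g) => [|j]; last first.
    by case E: (g j) => [x|] //= _; rewrite (gK _ _ E).
  apply: eq_big => [j|j _]; first by rewrite hK /= eqxx.
  by rewrite /pad /= !hK.
move=> j; case E: (g j) => [//|] _.
by rewrite /pad /= hK E mulr0.
Qed.

(** * Tensors with the support of matrix multiplication *)

Lemma s_rank_witness (X Y Z : finType) (T : tensor F X Y Z) :
  exists2 T' : tensor F X Y Z, tensor_supp T' = tensor_supp T &
    sum_of_products T' (s_rank T).
Proof.
rewrite /s_rank; case: ex_minnP => r /asboolP [T' [suppT' <-]] _.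
exists T' => //; rewrite /tensor_rank.
by case: ex_minnP => q /asboolP.
Qed.

Lemma tensor_supp_eq0 (X Y Z : finType) (T T' : tensor F X Y Z) x y z :
  tensor_supp T' = tensor_supp T -> (T' x y z == 0) = (T x y z == 0).
Proof.
by move=> /setP/(_ (x, y, z)); rewrite !inE /= => /(congr1 negb); rewrite !negbK.
Qed.

Lemma matmul_tensorE n (i j j' k k' i' : 'I_n) :
  matmul_tensor F n (i, j) (j', k) (k', i') =
    ((i == i') && (j == j') && (k == k'))%:R.
Proof.
rewrite /matmul_tensor.
rewrite (bigD1 i) //= (bigD1 j) //= (bigD1 k) //=.
rewrite 3?big1 ?addr0.
- rewrite !xpair_eqE !eqxx /= (eq_sym i') (eq_sym j') (eq_sym k').
  by case: (i == i'); case: (j == j'); case: (k == k').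
- move=> x xi; rewrite big1 // => y _; rewrite big1 // => z _.
  by rewrite !xpair_eqE (eq_sym i) (negbTE xi).
- move=> y yj; rewrite big1 // => z _.
  by rewrite !xpair_eqE (eq_sym j) (negbTE yj) ?andbF.
- by move=> z zk; rewrite !xpair_eqE (eq_sym k) (negbTE zk) ?andbF.
Qed.

(** Of the monomials with fixed output [(k, i)], only the pairs
    [(i, j)], [(j, k)] lie in the support. *)
Lemma matmul_supp_contract n (T : tensor F ('I_n * 'I_n)%type
    ('I_n * 'I_n)%type ('I_n * 'I_n)%type) i k (G : _ -> _ -> F) :
  tensor_supp T = tensor_supp (matmul_tensor F n) ->
  \sum_x \sum_y T x y (k, i) * G x y =
  \sum_j T (i, j) (j, k) (k, i) * G (i, j) (j, k).
Proof.
move=> suppT.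
have T0 x y : (x.1 == i) && (x.2 == y.1) && (y.2 == k) = false ->
    T x y (k, i) = 0.
  move=> xy; apply/eqP; rewrite (tensor_supp_eq0 _ _ _ suppT).
  by rewrite [x]surjective_pairing [y]surjective_pairing matmul_tensorE xy.
transitivity (\sum_i' \sum_j \sum_y T (i', j) y (k, i) * G (i', j) y).
  by rewrite [RHS]pair_bigA; apply: eq_bigr; case.
rewrite (bigD1 i) //= [X in _ + X]big1 ?addr0 => [|i' i'i]; last first.
  rewrite big1 // => j _; rewrite big1 // => y _.
  by rewrite T0 ?mul0r //= (negbTE i'i).
apply: eq_bigr => j _; rewrite (bigD1 (j, k)) //= big1 ?addr0 // => -[j' k'].
by rewrite xpair_eqE => ne; rewrite T0 ?mul0r //= eqxx eq_sym (negbTE ne).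
Qed.

(** One level of the recursion.  A matrix over ['I_m * J] is an [m] by [m] matrix
    of [J] by [J] blocks.  The rank decomposition of [T] forms [r] linear
    combinations of the blocks of each factor, multiplies them pairwise with the
    given program, and recombines the results; the weights multiply.  The three
    linear stages take [2 * m ^ 2 * r * #|J| ^ 2] operations each. *)
Lemma weighted_product_kron (m r : nat) (T : tensor F ('I_m * 'I_m)%type
    ('I_m * 'I_m)%type ('I_m * 'I_m)%type) (J : finType) s :
  sum_of_products T r -> tensor_supp T = tensor_supp (matmul_tensor F m) ->
  weighted_product_within J s ->
  weighted_product_within ('I_m * J)%type (r * s + 6 * r * m ^ 2 * #|J| ^ 2).
Proof.
move=> [alpha [beta [gamma TE]]] suppT [w w0 ws].
pose e (v : 'I_m * 'I_m) (u : J * J) : ('I_m * J) * ('I_m * J) :=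
  ((v.1, u.1), (v.2, u.2)).
exists (fun x y z => T (x.1, y.1) (y.1, z.1) (z.1, x.1) * w x.2 y.2 z.2).
  move=> x y z; rewrite mulf_neq0 //.
  by rewrite (tensor_supp_eq0 _ _ _ suppT) matmul_tensorE !eqxx oner_neq0.
have pre := computable_pair
  (computable_linear_family (fun (v : 'I_r * (J * J)) x => alpha v.1 x)
    (fun v x => inl (e x v.2) :
       ('I_m * J) * ('I_m * J) + ('I_m * J) * ('I_m * J)))
  (computable_linear_family (fun (v : 'I_r * (J * J)) x => beta v.1 x)
    (fun v x => inr (e x v.2) :
       ('I_m * J) * ('I_m * J) + ('I_m * J) * ('I_m * J))).
have rec := computable_family (fun l : 'I_r => computable_comp
  (computable_select (fun v : J * J + J * J => match v with
     | inl u => inl (l, u) | inr u => inr (l, u) end)) ws).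
have post := computable_linear_family
  (fun (v : ('I_m * J) * ('I_m * J)) (l : 'I_r) => gamma l (v.2.1, v.1.1))
  (fun v l => (l, (v.1.2, v.2.2))).
have := computable_comp (computable_comp pre rec) post.
set c := (X in computable_within _ X); set c' := (X in _ -> computable_within _ X).
have -> : c = c'.
  by rewrite /c /c' !card_prod !card_ord; ring.
apply: computable_ext => inp [[i a] [k b]].
rewrite /weighted_product /=.
under eq_bigr => l _ do rewrite mulr_sumr.
transitivity (\sum_j \sum_b' T (i, j) (j, k) (k, i) *
    w a b' b * inp (inl (i, a, (j, b'))) * inp (inr (j, b', (k, b)))); last first.
  by rewrite [LHS]pair_bigA; apply: eq_bigr; case.
rewrite exchange_big [RHS]exchange_big /=; apply: eq_bigr => b' _.
under [RHS]eq_bigr => j _ do rewrite -!mulrA.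
rewrite -(matmul_supp_contract _ _
  (fun x y => w a b' b * (inp (inl (e x (a, b'))) * inp (inr (e y (b', b))))))//.
under [RHS]eq_bigr => x _ do under eq_bigr => y _ do rewrite TE mulr_suml.
under [RHS]eq_bigr => x _ do rewrite exchange_big.
rewrite [RHS]exchange_big /=; apply: eq_bigr => l _.
rewrite mulrCA mulrAC mulrC mulr_suml; apply: eq_bigr => x _.
rewrite !mulr_sumr; apply: eq_bigr => y _; ring.
Qed.

(** Restricting the second and third variables to [y = (j, 0)], [z = (0, i)]
    indexed by [(i, j)] turns the tensor into an invertible diagonal matrix of
    size [n ^ 2], which factors through the [s_rank] products.  Only the support
    of the tensor matters. *)
Lemma sqrn_leq_s_rank_matmul n : (n ^ 2 <= s_rank (matmul_tensor F n))%N.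
Proof.
case: n => [|n]; first exact: leq0n.
have [T suppT [alpha [beta [gamma TE]]]] := s_rank_witness (matmul_tensor F n.+1).
move: (s_rank _) alpha beta gamma TE => r alpha beta gamma TE.
pose q := #|{: 'I_n.+1 * 'I_n.+1}|.
pose x (a : 'I_q) : 'I_n.+1 * 'I_n.+1 := enum_val a.
pose y (a : 'I_q) : 'I_n.+1 * 'I_n.+1 := ((x a).2, ord0).
pose z (a : 'I_q) : 'I_n.+1 * 'I_n.+1 := (ord0, (x a).1).
pose M := \matrix_(a, b) T (x a) (y b) (z b).
have -> : (n.+1 ^ 2)%N = q by rewrite /q card_prod card_ord mulnn.
have T0 a b : (T (x a) (y b) (z b) == 0) = (a != b).
  rewrite (tensor_supp_eq0 _ _ _ suppT) [x a]surjective_pairing.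
  rewrite matmul_tensorE eqxx andbT -(inj_eq enum_val_inj) -/(x a) -/(x b).
  rewrite -xpair_eqE -!surjective_pairing.
  by case: (x a == x b); rewrite ?oner_eq0 ?eqxx.
have ME : M = (\matrix_(a < q, l < r) alpha l (x a)) *m
              (\matrix_(l < r, b < q) (beta l (y b) * gamma l (z b))).
  by apply/matrixP => a b; rewrite !mxE TE; apply: eq_bigr => l _; rewrite !mxE mulrA.
have <- : \rank M = q; last by rewrite ME mulmx_max_rank.
apply: mxrank_unit.
have -> : M = diag_mx (\row_a M a a).
  apply/matrixP => a b; rewrite !mxE.
  have [->|ab] := eqVneq a b; first by rewrite mulr1n.
  by apply/eqP; rewrite mulr0n T0.
rewrite unitmxE det_diag unitfE prodf_seq_neq0; apply/allP => a _ /=.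
by rewrite !mxE T0 eqxx.
Qed.

(** The schoolbook decomposition; it shows that the exponents defining
    [omega_s] form a nonempty set. *)
Lemma s_rank_matmul_leq n : (s_rank (matmul_tensor F n) <= n ^ 3)%N.
Proof.
apply: (@leq_trans (tensor_rank (matmul_tensor F n))).
  rewrite /s_rank; case: ex_minnP => r _; apply.
  by apply/asboolP; exists (matmul_tensor F n).
rewrite /tensor_rank; case: ex_minnP => r _; apply; apply/asboolP.
have -> : (n ^ 3)%N = #|{: 'I_n * 'I_n * 'I_n}|.
  by rewrite !card_prod card_ord; ring.
pose t (l : 'I_#|{: 'I_n * 'I_n * 'I_n}|) : 'I_n * 'I_n * 'I_n := enum_val l.
exists (fun l x => (x == ((t l).1.1, (t l).1.2))%:R),
  (fun l y => (y == ((t l).1.2, (t l).2))%:R),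
  (fun l z => (z == ((t l).2, (t l).1.1))%:R) => x y z.
rewrite /matmul_tensor pair_bigA pair_bigA /=.
rewrite big_enum_val /=.
by apply: eq_bigr => l _; rewrite -!natrM !mulnb.
Qed.

End Costs.

(** * Iterating the recursion *)

Section Power.
Variable F : fieldType.

Lemma weighted_product_ord (J : finType) n s : (n <= #|J|)%N ->
  weighted_product_within F J s -> weighted_product_within F 'I_n s.
Proof.
move=> nJ; apply: (weighted_product_embed
  (h := fun i : 'I_n => enum_val (widen_ord nJ i))).
by move=> i j /enum_val_inj [] /val_inj.
Qed.

(** The cost obeys [s (k + 1) = r * s k + D * (m ^ 2) ^ k] with [m ^ 2 <= r].  The
    strict gap between [r] and [rho] absorbs the factor [k] that this recurrence
    would produce at [rho = r]. *)
Lemma weighted_product_power (R : realType) m r (T : tensor F ('I_m * 'I_m)%type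
    ('I_m * 'I_m)%type ('I_m * 'I_m)%type) (rho : R) :
  sum_of_products T r -> tensor_supp T = tensor_supp (matmul_tensor F m) ->
  (m ^ 2 <= r)%N -> r%:R < rho ->
  exists E : R, forall k,
    exists2 s, s%:R <= E * rho ^+ k & weighted_product_within F 'I_(m ^ k) s.
Proof.
move=> Tr suppT mr r_rho; pose D : R := (6 * r * m ^ 2)%:R.
have gap : 0 < rho - r%:R by rewrite subr_gt0.
have D0 : 0 <= D by exact: ler0n.
(* [1] starts the induction, and [E * (rho - r) >= D] carries it on. *)
exists (1 + D / (rho - r%:R)); elim=> [|k [s sE sW]].
  exists 1%N; first by rewrite mulr1 lerDl divr_ge0 // ltW.
  by apply: weighted_product_ord (weighted_product_unit F); rewrite card_unit.
exists (r * s + 6 * r * m ^ 2 * #|'I_(m ^ k)| ^ 2)%N; last first.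
  apply: weighted_product_ord (weighted_product_kron Tr suppT sW).
  by rewrite card_prod !card_ord expnS.
rewrite card_ord natrD [X in _ + X]natrM -/D natrM -expnM mulnC expnM natrX.
have mk : ((m ^ 2)%:R : R) ^+ k <= rho ^+ k.
  by rewrite lerXn2r ?nnegrE ?ler0n ?(le_trans _ (ltW r_rho)) ?ler0n // ler_nat.
set E := 1 + _ in sE *.
have ED : D <= E * (rho - r%:R).
  by rewrite mulrDl mul1r divfK ?gt_eqF // lerDr ltW.
have rhok : 0 <= rho ^+ k by apply: exprn_ge0; apply: le_trans (ltW r_rho).
apply: (@le_trans _ _ (r%:R * (E * rho ^+ k) + D * rho ^+ k)).
  by rewrite lerD // ler_wpM2l.
rewrite exprS; have := ler_wpM2r rhok ED; lra.
Qed.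

End Power.

(** * Exponents *)

Section Asymptotics.
Variable R : realType.

Lemma near_ltr_natpowR (c d : R) : 0 < d -> \forall n \near \oo, c < n%:R `^ d.
Proof.
move=> d0; have c1 : 0 <= Num.max c 1 by rewrite le_max ler01 orbT.
near=> n; apply: (@le_lt_trans _ _ (Num.max c 1)); first by rewrite le_max lexx.
have -> : Num.max c 1 = (Num.max c 1 `^ d^-1) `^ d.
  by rewrite -powRrM mulVf ?powRr1 // lt0r_neq0.
apply: gt0_ltr_powR; rewrite ?nnegrE ?powR_ge0 ?ler0n //.
by near: n; exact: nbhs_infty_gtr.
Unshelve. all: by end_near. Qed.

(** An exponent [tau < sigma] in the set defining [omega_s] bounds the s-rank
    by [C * m ^ tau], and [m ^ (sigma - tau)] outgrows the constant [C]. *)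
Lemma omega_s_lt_witness (sigma : R) : omega_s R < sigma ->
  exists2 m, (1 < m)%N & (s_rank (matmul_tensor R[i] m))%:R < m%:R `^ sigma.
Proof.
move=> lt_sigma; have [|tau] := inf_lt _ lt_sigma.
  exists 3 => /=; apply/eqO_exP; exists 1 => //; near=> n.
  by rewrite mul1r powR_mulrn ?ler0n // -natrX !normr_nat ler_nat s_rank_matmul_leq.
move=> /= /eqO_exP [C C0 bigO] tau_sigma.
have d0 : 0 < sigma - tau by rewrite subr_gt0.
have [m] : exists m, [/\ (1 < m)%N, C < m%:R `^ (sigma - tau) &
    (s_rank (matmul_tensor R[i] m))%:R <= C * m%:R `^ tau].
  apply: (@filter_ex _ \oo); near=> m; split; first by near: m; exact: nbhs_infty_gt.
    by near: m; exact: near_ltr_natpowR.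
  rewrite -[leLHS]normr_nat -[X in _ * X]ger0_norm ?powR_ge0 //.
  by near: m; exact: bigO.
case=> m1 Cm sm; exists m => //; apply: le_lt_trans sm _.
have m0 : (m%:R : R) != 0 by rewrite pnatr_eq0; case: (m) m1.
rewrite -[sigma](subrK tau) powRD ?m0 ?implybT // ltr_pM2r //.
by rewrite powR_gt0 // lt0r m0 ler0n.
Unshelve. all: by end_near. Qed.

(** Rounding [n] up to the next power of [m] loses a factor at most [m], that is
    [m ^ sigma] in the cost, which the constant absorbs. *)
Lemma weighted_product_leq_powR (sigma : R) : omega_s R < sigma ->
  exists E : R, forall n, (1 < n)%N ->
    exists2 s, s%:R <= E * n%:R `^ sigma & weighted_product_within R[i] 'I_n s.
Proof.
move=> /omega_s_lt_witness [m m1 m_sigma].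
have [T suppT Tr] := s_rank_witness (matmul_tensor R[i] m).
have mr := sqrn_leq_s_rank_matmul R[i] m.
have [E Ek] := weighted_product_power Tr suppT mr m_sigma.
have mge1 : (1 : R) <= m%:R by rewrite ler1n ltnW.
(* Otherwise [m ^ 2 <= r < m ^ sigma <= 1]. *)
have sigma0 : 0 <= sigma.
  rewrite leNgt; apply/negP => sigma_lt0.
  have : (m%:R : R) `^ sigma <= m%:R `^ 0 by apply: ler_powR => //; exact: ltW.
  rewrite powRr0 leNgt => /negP; apply; apply: le_lt_trans m_sigma.
  by rewrite ler1n (leq_trans _ mr) // expn_gt0 ltnW.
have E0 : 0 <= E.
  by have [s] := Ek 0%N; rewrite mulr1 => /(le_trans _) ->.
exists (E * m%:R `^ sigma) => n n1.
have /andP[lo hi] := up_log_bounds m1 n1; set k := up_log m n in lo hi.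
have k0 : (0 < k)%N by case: (k) hi n1; first by rewrite expn0; case: (n) => [|[]].
have [s sE sW] := Ek k; exists s; last first.
  by apply: weighted_product_ord sW; rewrite card_ord.
apply: le_trans sE _; rewrite -mulrA ler_wpM2l //.
rewrite -powR_mulrn ?powR_ge0 // powRAC powR_mulrn ?ler0n // -natrX.
rewrite -powRM ?ler0n //; apply: ge0_ler_powR; rewrite ?nnegrE ?mulr_ge0 ?ler0n //.
by rewrite -natrM ler_nat -(prednK k0) expnS leq_mul2l (ltnW lo) orbT.
Qed.

Lemma near_weighted_product_leq (eps : R) : 0 < eps ->
  \forall n \near \oo, exists2 s, s%:R <= n%:R `^ (omega_s R + eps) &
    weighted_product_within R[i] 'I_n s.
Proof.
move=> eps0; have eps2 : 0 < eps / 2 by rewrite divr_gt0.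
have [|E En] := @weighted_product_leq_powR (omega_s R + eps / 2).
  by rewrite ltrDl.
near=> n.
have n1 : (1 < n)%N by near: n; exact: nbhs_infty_gt.
have [s sE sW] := En n n1; exists s => //; apply: le_trans sE _.
have n0 : (n%:R : R) != 0 by rewrite pnatr_eq0; case: (n) n1.
have -> : omega_s R + eps = eps / 2 + (omega_s R + eps / 2) by lra.
rewrite (powRD (r := eps / 2)) ?n0 ?implybT // ler_wpM2r ?powR_ge0 // ltW //.
by near: n; exact: near_ltr_natpowR.
Unshelve. all: by end_near. Qed.

(** The correction [e n] is the positive part of [log_n (S n) - w].  The case
    [S n = 0] is separate because [ln 0 = 0] says nothing about the size of
    [S n] there. *)
Lemma exponent_of_count (S : nat -> nat) (w : R) :
  (forall eps : R, 0 < eps ->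
     \forall n \near \oo, (S n)%:R <= n%:R `^ (w + eps)) ->
  exists2 e : nat -> R, e n @[n --> \oo] --> (0 : R) &
    \forall n \near \oo, (S n)%:R <= n%:R `^ (w + e n).
Proof.
move=> Sle.
exists (fun n => if S n == 0%N then 0
                 else Num.max 0 (ln (S n)%:R / ln n%:R - w)).
  apply/cvgr0Pnorm_le => eps eps0; near=> n.
  have n1 : (1 < n)%N by near: n; exact: nbhs_infty_gt.
  have lnn : 0 < ln (n%:R : R) by rewrite ln_gt0 // ltr1n.
  case: eqP => [_|/eqP S0]; first by rewrite normr0 ltW.
  rewrite ger0_norm ?le_max ?lexx // ge_max ltW //= lerBlDl ler_pdivrMr //.
  rewrite -ln_powR ler_ln ?posrE ?powR_gt0 ?ltr0n ?lt0n ?(gtn_eqF (ltnW n1)) //.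
  by near: n; exact: Sle.
near=> n.
have n1 : (1 < n)%N by near: n; exact: nbhs_infty_gt.
have lnn : 0 < ln (n%:R : R) by rewrite ln_gt0 // ltr1n.
have [->|S0] := eqVneq (S n) 0%N; first exact: powR_ge0.
rewrite -ler_ln ?posrE ?powR_gt0 ?ltr0n ?lt0n ?(gtn_eqF (ltnW n1)) //.
by rewrite ln_powR -ler_pdivrMr // -lerBlDl le_max lexx orbT.
Unshelve. all: by end_near. Qed.

End Asymptotics.

(** * Random choices *)

Section Probability.
Variable R : realType.

Lemma choice_prob_half n (E : {set 'M[bool]_n}) (f : 'M[bool]_n -> 'M[bool]_n) :
  injective f -> (forall c, c \notin E -> f c \in E) ->
  2^-1 <= choice_prob R E.
Proof.
move=> f_inj fE.
have card : (#|{: 'M[bool]_n}| <= 2 * #|E|)%N.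
  rewrite -(cardsC E) mulSn mul1n leq_add2l -(card_imset _ f_inj).
  apply: subset_leq_card; apply/fintype.subsetP => _ /imsetP [c cE ->].
  by apply: fE; rewrite inE in cE.
have pos : (0 < #|{: 'M[bool]_n}|)%N by apply/card_gt0P; exists (const_mx false).
rewrite /choice_prob ler_pdivlMr ?ltr0n // ler_pdivrMl //.
by rewrite -natrM ler_nat.
Qed.

(** Switching the choice at [(j, k)], for a [j] witnessing the Boolean product,
    changes the entry by [w i j k] up to sign, so it cannot vanish both before
    and after. *)
Lemma weighted_choice_prob (F : numFieldType) n (w : 'I_n -> 'I_n -> 'I_n -> F)
    (A B : 'M[bool]_n) i k (P : 'M[bool]_n -> F) :
  (forall i j k, w i j k != 0) ->
  (forall c, P c =
     \sum_j w i j k * lift_mx F A i j * choice_lift_mx F B c j k) ->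
  bool_mulmx A B i k -> 2^-1 <= choice_prob R [set c | P c != 0]%SET.
Proof.
move=> w0 PE; rewrite mxE big_orE => /existsP [j /= /andP[Aij Bjk]].
pose flip (c : 'M[bool]_n) : 'M[bool]_n :=
  \matrix_(j', k') (((j' == j) && (k' == k)) (+) c j' k').
have flipK : involutive flip.
  by move=> c; apply/matrixP => j' k'; rewrite !mxE addbA addbb.
apply: (choice_prob_half (inv_inj flipK)) => c; rewrite !inE negbK !PE.
rewrite (bigD1 j) //= [in X in _ -> X](bigD1 j) //= => /eqP Pc.
rewrite [X in _ + X](eq_bigr (fun j' =>
  w i j' k * lift_mx F A i j' * choice_lift_mx F B c j' k)); last first.
  by move=> j' ne; rewrite /choice_lift_mx /flip !mxE (negbTE ne).
apply/negP => /eqP Pc'.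
suff : w i j k = 0 by move/eqP; rewrite (negbTE (w0 i j k)).
move: Pc Pc'; set rest := \sum_(_ | _) _.
rewrite /lift_mx /choice_lift_mx /flip !mxE Aij Bjk !eqxx /=.
(* The slope is the difference between the entries for the values 2 and 1. *)
have slope : w i j k =
  (w i j k * 1%:R * 2 + rest) - (w i j k * 1%:R * 1 + rest) by ring.
by case: (c j k) => /= Pc Pc'; rewrite slope Pc Pc' subr0.
Qed.

End Probability.

(** * Shortest programs for weighted products *)

Theorem theorem3p7 (R : realType) :
  exists alg : forall n : nat, mx_program R[i] n,
    (exists2 e : nat -> R, e n @[n --> \oo] --> (0 : R) &
       \forall n \near \oo,
         (num_ops (alg n))%:R <= n%:R `^ (omega_s R + e n)) /\
    (forall (n : nat) (A B : 'M[bool]_n),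
       exists C : 'M[bool]_n -> 'M[R[i]]_n,
         (forall c : 'M[bool]_n,
            mx_computes (alg n) (lift_mx R[i] A) (choice_lift_mx R[i] B c)
              (C c)) /\
         (forall i j : 'I_n,
            (bool_mulmx A B i j = false -> forall c, C c i j = 0) /\
            (bool_mulmx A B i j = true ->
               2^-1 <= choice_prob R [set c | C c i j != 0]%SET))).
Proof.
have [S [Smin Sle]] : exists S : nat -> nat,
    (forall n, weighted_product_within R[i] 'I_n (S n)) /\
    (forall n s, weighted_product_within R[i] 'I_n s -> (S n <= s)%N).
  have ex n : exists s, `[< weighted_product_within R[i] 'I_n s >].
    (* Any exponent will do here; sizes 0 and 1 are padded to size [n + 2]. *)
    have [|E En] := @weighted_product_leq_powR R (omega_s R + 1).
      by rewrite ltrDl.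
    have [s _ sW] := En n.+2 isT; exists s; apply/asboolP.
    apply: weighted_product_ord sW.
    by rewrite card_ord -addn2 leq_addr.
  exists (fun n => ex_minn (ex n)); split=> n.
    by case: ex_minnP => s /asboolP.
  by move=> s sW; case: ex_minnP => t _; apply; apply/asboolP.
have algP n : exists p : mx_program R[i] n, (num_ops p <= S n)%N /\
    exists2 w : 'I_n -> 'I_n -> 'I_n -> R[i], (forall i j k, w i j k != 0) &
      forall inp, computes p inp (weighted_product w inp).
  by have [w w0 [p pS pw]] := Smin n; exists p; split=> //; exists w.
pose alg n := sval (cid (algP n)).
have alg_size n : (num_ops (alg n) <= S n)%N by case: (svalP (cid (algP n))).
exists alg; split.
  have [|e e0 Se] := @exponent_of_count R S (omega_s R).
    move=> eps eps0; near=> n.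
    have [s sle /Sle Ss] : exists2 s, s%:R <= n%:R `^ (omega_s R + eps) &
        weighted_product_within R[i] 'I_n s.
      by near: n; exact: near_weighted_product_leq.
    by apply: le_trans sle; rewrite ler_nat.
  exists e => //; near=> n.
  apply: (@le_trans _ _ (S n)%:R); first by rewrite ler_nat.
  by near: n; exact: Se.
move=> n A B; have [w w0 pw] := (svalP (cid (algP n))).2.
pose C (c : 'M[bool]_n) : 'M[R[i]]_n := \matrix_(i, k)
  \sum_j w i j k * lift_mx R[i] A i j * choice_lift_mx R[i] B c j k.
exists C; split=> [c|i k].
  have [mem pE wE] := pw (fun v => match v with
    | inl ij => lift_mx R[i] A ij.1 ij.2
    | inr ij => choice_lift_mx R[i] B c ij.1 ij.2 end).
  by exists mem => // u; rewrite wE mxE.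
split=> [AB0 c|AB1].
  rewrite mxE big1 // => j _; rewrite !mxE.
  move: AB0; rewrite mxE big_orE => /negbT; rewrite negb_exists.
  move=> /forallP/(_ j) /=; rewrite negb_and => /orP[/negbTE->|/negbTE->].
    by rewrite mulr0 mul0r.
  by rewrite mulr0.
by apply: (weighted_choice_prob R w0 _ AB1) => c; rewrite mxE.
Unshelve. all: by end_near. Qed.
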